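(* Let $X$ be a metrizable semitopological group that is a Baire space, with identity $1_X$. Let $\{z_n\}_{n\in\mathbb{N}}$ be a sequence in $X$ with $z_n\to 1_X$, and let $A\subseteq X$ be a non-meagre set with the Baire property. Then for some $a\in A$ and some $n=n(a)\in\mathbb{N}$, $$\{a z_m : m>n\}\subseteq A .$$ In fact, this embedding holds for quasi almost all $a\in A$: there is a meagre set $M\subseteq X$ such that for every $a\in A\setminus M$ there is $n=n(a)\in\mathbb{N}$ with $\{a z_m: m>n\}\subseteq A$.
   Context: A group $X$ with a topology is semitopological if all left and right translations are continuous. A space is Baire if it obeys Baire's Category Theorem. A set has the Baire property if it equals an open set modulo a meagre set. ''Quasi almost all'' means for all points off a meagre set. *)

(* Defs.v *)
From HB Require Import structures.
From mathcomp Require Import all_boot all_order all_algebra.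
From mathcomp Require Import all_classical all_reals topology.

Set Implicit Arguments.
Unset Strict Implicit.
Unset Printing Implicit Defensive.

Local Open Scope classical_set_scope.

HB.mixin Record isSemitopologicalGroup G of Group G & Topological G := {
  ltrans_continuous : forall x : G, continuous (fun y : G => (x * y)%g) ;
  rtrans_continuous : forall x : G, continuous (fun y : G => (y * x)%g)
}.

(* Neither joint continuity of the product nor continuity of the inverse is
   required, and no separation axiom is built in. *)
#[short(type="semitopologicalGroupType")]
HB.structure Definition SemitopologicalGroup :=
  {G of Group G & Topological G & isSemitopologicalGroup G}.

(* [metricType R] has a fixed distance; metrizability only asks for
   a homeomorphism f, with inverse g, onto some metric space. *)
Definition metrizable (R : realType) (T : topologicalType) : Prop :=
  exists (M : metricType R) (f : T -> M) (g : M -> T),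
    [/\ cancel f g, cancel g f, continuous f & continuous g].

Definition baire_space (T : topologicalType) : Prop :=
  forall F : nat -> set T,
    (forall i, open (F i) /\ dense (F i)) -> dense (\bigcap_i F i).

Definition nowhere_dense (T : topologicalType) (A : set T) : Prop :=
  interior (closure A) = set0.

Definition meagre (T : topologicalType) (A : set T) : Prop :=
  exists2 F : nat -> set T,
    (forall i, nowhere_dense (F i)) & A = \bigcup_i F i.

(* [`+`] is the symmetric difference of sets. *)
Definition baire_property (T : topologicalType) (A : set T) : Prop :=
  exists2 U : set T, open U & meagre (A `+` U).

(* Main.v *)
(** Write [N] for the meagre symmetric difference of [A] and an open set [U].
    Right translations are homeomorphisms, so the points [a] for which [a] or
    some [a * z m] lies in [N] form a meagre set [M].  If [a] is in [A] but
    not in [M], then [a] is in [U]; since [a * z m] tends to [a], these products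
    are eventually in [U], hence in [A] as they avoid [N]. *)

Require Import Defs.
From HB Require Import structures.
From mathcomp Require Import all_boot all_order all_algebra.
From mathcomp Require Import all_classical all_reals topology.

Set Implicit Arguments.
Unset Strict Implicit.
Unset Printing Implicit Defensive.

Local Open Scope classical_set_scope.

Lemma nowhere_dense_subset (T : topologicalType) (A B : set T) :
  A `<=` B -> nowhere_dense B -> nowhere_dense A.
Proof.
by move=> AB ndB; rewrite /nowhere_dense -subset0 -ndB;
  exact/interiorS/closureS.
Qed.

Lemma meagre_subset (T : topologicalType) (A B : set T) :
  A `<=` B -> meagre B -> meagre A.
Proof.
(* [meagre] asks for equality with the union, so each piece is cut down to [A]. *)
move=> AB [F ndF BE]; exists (fun i => A `&` F i) => [i|].
  exact: nowhere_dense_subset (@subIsetr _ _ _) (ndF i).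
by rewrite -setI_bigcupr -BE; exact/esym/setIidl.
Qed.

Lemma meagre_bigcup (T : topologicalType) (N : nat -> set T) :
  (forall n, meagre (N n)) -> meagre (\bigcup_n N n).
Proof.
move=> mN.
have /choice[F FP] n : exists F : nat -> set T,
    (forall i, nowhere_dense (F i)) /\ N n = \bigcup_i F i.
  by have [F] := mN n; exists F.
(* The double union is enumerated by decoding [k] into a pair; codes of no pair fall back on
   [(0, 0)], which merely repeats the piece [F 0 0]. *)
pose p k : nat * nat := odflt (0, 0)%N (unpickle k).
exists (fun k => F (p k).1 (p k).2) => [k|]; first exact: (FP _).1.
apply/seteqP; split=> x [n _].
  rewrite (FP n).2 => -[i _ Fx]; exists (pickle (n, i)) => //.
  by rewrite /p pickleK.
by move=> Fx; exists (p n).1 => //; rewrite (FP _).2; exists (p n).2.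
Qed.

(** A homeomorphism carries an open set inside the closure of the preimage to an open set inside the
    closure of [N]. *)
Lemma nowhere_dense_preimage (S T : topologicalType) (f : S -> T)
    (g : T -> S) (N : set T) :
  cancel f g -> cancel g f -> continuous f -> continuous g ->
  nowhere_dense N -> nowhere_dense (f @^-1` N).
Proof.
move=> fK gK cf cg ndN; rewrite /nowhere_dense -subset0 => x.
set O := interior _ => Ox.
have Osub : g @^-1` O `<=` closure N.
  move=> y /interior_subset clgy; rewrite -(gK y) => B /cf Bgy.
  by have [w [Nw Bw]] := clgy _ Bgy; exists (f w).
have oO : open (g @^-1` O).
  by apply: open_comp => [y _|]; [exact: cg|exact: open_interior].
suff : interior (closure N) (f x) by rewrite ndN.
by move: Osub; rewrite open_subsetE//; apply; rewrite /= fK.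
Qed.

Lemma meagre_preimage (S T : topologicalType) (f : S -> T)
    (g : T -> S) (N : set T) :
  cancel f g -> cancel g f -> continuous f -> continuous g ->
  meagre N -> meagre (f @^-1` N).
Proof.
move=> fK gK cf cg [F ndF ->]; exists (fun i => f @^-1` F i).
  by move=> i; exact: nowhere_dense_preimage cg (ndF i).
exact: preimage_bigcup.
Qed.

Lemma meagre_rtrans (X : semitopologicalGroupType) (x : X) (N : set X) :
  meagre N -> meagre [set a : X | N (a * x)%g].
Proof.
apply: (@meagre_preimage _ _ (fun a => a * x)%g (fun a => a * x^-1)%g).
- exact: mulgK.
- exact: mulgVK.
- exact: rtrans_continuous.
- exact: rtrans_continuous.
Qed.

Theorem theorem2 (R : realType) (X : semitopologicalGroupType)
    (Xmetrizable : metrizable R X) (Xbaire : baire_space X)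
    (z : nat -> X) (z_cvg : z n @[n --> \oo] --> (1%g : X))
    (A : set X) (Anonmeagre : ~ meagre A) (Abaire : baire_property A) :
  (exists2 a : X, A a &
     exists n : nat, [set (a * z m)%g | m in [set m | (n < m)%N]] `<=` A) /\
  (exists2 M : set X, meagre M &
     forall a : X, (A `\` M) a ->
       exists n : nat, [set (a * z m)%g | m in [set m | (n < m)%N]] `<=` A).
Proof.
have [U oU mN] := Abaire.
(* Putting the identity in front of the sequence lets one union [M] control both [a] (index 0) and
   every [a * z m] (index [m.+1]). *)
pose t k := if k is m.+1 then z m else (1%g : X).
pose M := \bigcup_k [set a : X | (A `+` U) (a * t k)%g].
have mM : meagre M by apply: meagre_bigcup => k; exact: meagre_rtrans.
have embed (a : X) : (A `\` M) a ->
    exists n : nat, [set (a * z m)%g | m in [set m | (n < m)%N]] `<=` A.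
  move=> [Aa nMa].
  have Ua : U a.
    apply: contrapT => nUa; apply: nMa; exists 0%N => //=.
    by rewrite mulg1; left.
  have az_cvg : (a * z n)%g @[n --> \oo] --> a.
    (* Writing the limit as [a * 1] reduces the claim to continuity of left translation by [a] at
       the identity. *)
    rewrite -[X in _ --> X](mulg1 a).
    exact: continuous_cvg (ltrans_continuous a _) z_cvg.
  have [n _ Un] := az_cvg _ (open_nbhs_nbhs (conj oU Ua)).
  (* [Un] covers all [m >= n], so [n < m] is weakened. A product in [U] but outside [A] would lie in
     the symmetric difference, putting [a] in [M]. *)
  exists n => _ [m /= /ltnW nm <-]; apply: contrapT => nA.
  by apply: nMa; exists m.+1 => //; right; split => //; exact: Un.
split; last by exists M.
(* Otherwise [A] would be contained in [M], hence meagre. *)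
have [a [Aa nMa]] : (A `\` M) !=set0.
  apply/set0P/eqP; rewrite setD_eq0 => AM.
  exact/Anonmeagre/(meagre_subset AM).
by exists a => //; exact: embed.
Qed.
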